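(* Let $(Q,+,\cdot,\le)$ be an ordered field and $n\ge 2$, and assume $n=2$ or that $(Q,+,\cdot,\le)$ is a Euclidean field. Let $$\mathcal{W}_{\sigma\to\lambda}(x,y):=\neg(x\,\sigma\,y)\wedge x\neq y\wedge\forall u\,\forall v\,\exists z_u\,\exists z_v\,\big((\neg(z_u\,\sigma\,u)\wedge z_u\,\sigma\,x\wedge z_u\,\sigma\,y)\vee(\neg(z_v\,\sigma\,v)\wedge z_v\,\sigma\,x\wedge z_v\,\sigma\,y)\vee\neg(u\,\sigma\,v)\big),$$ $$\mathcal{W}_{\sigma\to\tau}(x,y):=\neg\mathcal{W}_{\sigma\to\lambda}(x,y)\wedge\neg(x\,\sigma\,y)\wedge x\neq y.$$ Then in $(Q^n,\sigma)$ the formula $\mathcal{W}_{\sigma\to\lambda}$ (equivalent to a $\forall^2\exists^2$-formula, 6 variables) defines the relation $\lambda$, and the formula $\mathcal{W}_{\sigma\to\tau}$ (equivalent to an $\exists^2\forall^2$-formula) defines the relation $\tau$.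
   Context: For $p=(p_0,\dots,p_{n-1}),\,q=(q_0,\dots,q_{n-1})\in Q^n$: $p\,\tau\,q$ iff $(p_0-q_0)^2>\sum_{i=1}^{n-1}(p_i-q_i)^2$; $p\,\lambda\,q$ iff $(p_0-q_0)^2=\sum_{i=1}^{n-1}(p_i-q_i)^2$ and $p_0\neq q_0$; $p\,\sigma\,q$ iff $(p_0-q_0)^2<\sum_{i=1}^{n-1}(p_i-q_i)^2$. An ordered field is Euclidean if every nonnegative element is a square. A formula $\varphi(x,y)$ defines $R$ in $(Q^n,\sigma)$ if for all $a,b\in Q^n$, $\varphi(a,b)$ holds (symbol $\sigma$ interpreted as $\sigma$, quantifiers over $Q^n$) iff $(a,b)\in R$. *)

(* Defs.v *)
From HB Require Import structures.
From mathcomp Require Import all_boot all_order all_algebra.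

Set Implicit Arguments.
Unset Strict Implicit.
Unset Printing Implicit Defensive.

Import Order.TTheory GRing.Theory Num.Theory.

(* First-order formulas with equality over one binary relation symbol.
   Variables are named by natural numbers. *)
Inductive formula : Type :=
  | fRel of nat & nat
  | fEq of nat & nat
  | fNot of formula
  | fAnd of formula & formula
  | fOr of formula & formula
  | fAll of nat & formula
  | fEx of nat & formula.

Definition update (A : Type) (e : nat -> A) (i : nat) (a : A) : nat -> A :=
  fun j => if j == i then a else e j.

(* Tarskian satisfaction in the structure (A, r) under the assignment e. *)
Fixpoint sat (A : Type) (r : A -> A -> Prop) (e : nat -> A) (phi : formula) :
    Prop :=
  match phi with
  | fRel i j => r (e i) (e j)
  | fEq i j => e i = e j
  | fNot f => ~ sat r e f
  | fAnd f g => sat r e f /\ sat r e g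
  | fOr f g => sat r e f \/ sat r e g
  | fAll i f => forall a : A, sat r (update e i a) f
  | fEx i f => exists a : A, sat r (update e i a) f
  end.

Definition logically_equivalent (phi psi : formula) : Prop :=
  forall (A : Type) (r : A -> A -> Prop) (e : nat -> A),
    sat r e phi <-> sat r e psi.

Fixpoint quantifier_free (phi : formula) : bool :=
  match phi with
  | fRel _ _ | fEq _ _ => true
  | fNot f => quantifier_free f
  | fAnd f g | fOr f g => quantifier_free f && quantifier_free g
  | fAll _ _ | fEx _ _ => false
  end.

Definition is_forall2_exists2 (phi : formula) : bool :=
  if phi is fAll _ (fAll _ (fEx _ (fEx _ q))) then quantifier_free q else false.

Definition is_exists2_forall2 (phi : formula) : bool :=
  if phi is fEx _ (fEx _ (fAll _ (fAll _ q))) then quantifier_free q else false.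

(* All variables occurring in a formula, free or bound, with repetitions. *)
Fixpoint vars (phi : formula) : seq nat :=
  match phi with
  | fRel i j | fEq i j => [:: i; j]
  | fNot f => vars f
  | fAnd f g | fOr f g => vars f ++ vars g
  | fAll i f | fEx i f => i :: vars f
  end.

Definition num_vars (phi : formula) : nat := size (undup (vars phi)).

Definition vx : nat := 0.
Definition vy : nat := 1.
Definition vu : nat := 2.
Definition vv : nat := 3.
Definition vzu : nat := 4.
Definition vzv : nat := 5.

(* phi(x, y) defines R in (A, r).  The values of the variables other than
   x and y are arbitrary, so the truth of phi cannot depend on them. *)
Definition defines (A : Type) (r : A -> A -> Prop) (phi : formula)
    (R : A -> A -> Prop) : Prop :=
  forall e : nat -> A, sat r e phi <-> R (e vx) (e vy).

Definition W_sigma_lambda : formula :=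
  fAnd (fAnd (fNot (fRel vx vy)) (fNot (fEq vx vy)))
    (fAll vu (fAll vv (fEx vzu (fEx vzv
      (fOr (fOr
        (fAnd (fAnd (fNot (fRel vzu vu)) (fRel vzu vx)) (fRel vzu vy))
        (fAnd (fAnd (fNot (fRel vzv vv)) (fRel vzv vx)) (fRel vzv vy)))
        (fNot (fRel vu vv))))))).

Definition W_sigma_tau : formula :=
  fAnd (fAnd (fNot W_sigma_lambda) (fNot (fRel vx vy))) (fNot (fEq vx vy)).

Local Open Scope ring_scope.

Definition euclidean_field (Q : realFieldType) : Prop :=
  forall x : Q, 0 <= x -> exists y : Q, x = y ^+ 2.

(* The space is Q^(n+1); the first coordinate of p is p 0 0 and the others
   are the p 0 i with 0 < i. *)
Definition time2 (Q : realFieldType) (n : nat) (p q : 'rV[Q]_n.+1) : Q :=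
  (p 0 0 - q 0 0) ^+ 2.

Definition space2 (Q : realFieldType) (n : nat) (p q : 'rV[Q]_n.+1) : Q :=
  \sum_(i < n.+1 | (0 < i)%N) (p 0 i - q 0 i) ^+ 2.

Definition tau (Q : realFieldType) (n : nat) (p q : 'rV[Q]_n.+1) : Prop :=
  time2 p q > space2 p q.

Definition lambda (Q : realFieldType) (n : nat) (p q : 'rV[Q]_n.+1) : Prop :=
  time2 p q = space2 p q /\ p 0 0 <> q 0 0.

Definition sigma (Q : realFieldType) (n : nat) (p q : 'rV[Q]_n.+1) : Prop :=
  time2 p q < space2 p q.

(* Main.v *)
(** Write [q] for the quadratic form time^2 - space^2 and [B] for its polar form.

    If [x] and [y] are timelike related, two spacelike related points [u], [v]
    near the midpoint lie in the causal diamond between [x] and [y]; by the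
    reverse triangle inequality any point causally related to such a point is
    causally related to [x] or to [y], so the quantified clause fails.

    If [k = y - x] is null, every point [u] off the line through [x] and [y]
    is causally related to some [z] spacelike to both.  Put [p = u - x].  If
    [B p k <> 0], then [q] has the same nonzero slope along the lines
    [p + s k] and [p - k + s k], so [z = u + s k] works for a suitable [s].  If
    [B p k = 0], then [q (p - k) = q p], which is negative off the line, so
    [z = u] works.  Two spacelike related points cannot both be on that line. *)
Require Import Defs.
From HB Require Import structures.
From mathcomp Require Import all_boot all_order all_algebra.
From mathcomp Require Import ring lra.
From Stdlib Require Import Classical.

Set Implicit Arguments.
Unset Strict Implicit.
Unset Printing Implicit Defensive.

Import Order.TTheory GRing.Theory Num.Theory.

Section Minkowski.
Local Open Scope ring_scope.
Variables (Q : realFieldType) (n : nat).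
Implicit Types (c s : Q) (p r w x y z u v k : 'rV[Q]_n.+1).

(** * The Minkowski form and the three relations *)

Definition minkowski p r : Q :=
  p 0 0 * r 0 0 - \sum_(i < n.+1 | (0 < i)%N) p 0 i * r 0 i.

Local Notation B := minkowski.
Local Notation q p := (minkowski p p).

Lemma minkowskiC p r : B p r = B r p.
Proof. by rewrite /B mulrC; under eq_bigr do rewrite mulrC. Qed.

Lemma minkowskiDl p w r : B (p + w) r = B p r + B w r.
Proof.
rewrite /B mxE; under eq_bigr do rewrite mxE mulrDl.
by rewrite big_split /=; ring.
Qed.

Lemma minkowskiZl c p r : B (c *: p) r = c * B p r.
Proof.
rewrite /B mxE; under eq_bigr do rewrite mxE -mulrA.
by rewrite -mulr_sumr; ring.
Qed.

Lemma minkowskiDr p w r : B r (p + w) = B r p + B r w.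
Proof. by rewrite !(minkowskiC r) minkowskiDl. Qed.

Lemma minkowskiZr c p r : B r (c *: p) = c * B r p.
Proof. by rewrite !(minkowskiC r) minkowskiZl. Qed.

Lemma minkowskiNl p r : B (- p) r = - B p r.
Proof. by rewrite -scaleN1r minkowskiZl mulN1r. Qed.

Lemma minkowskiNr p r : B r (- p) = - B r p.
Proof. by rewrite !(minkowskiC r) minkowskiNl. Qed.

Definition minkowskiE := (minkowskiDl, minkowskiDr, minkowskiZl, minkowskiZr,
  minkowskiNl, minkowskiNr).

Lemma minkowski_distC p r : q (p - r) = q (r - p).
Proof. by rewrite -opprB minkowskiNl minkowskiNr opprK. Qed.

Lemma minkowski_sub p r : q (p - r) = time2 p r - space2 p r.
Proof.
rewrite /B /time2 /space2 !mxE expr2; congr (_ - _).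
by apply: eq_bigr => i _; rewrite !mxE expr2.
Qed.

Lemma sigmaE p r : sigma p r <-> q (p - r) < 0.
Proof. by rewrite minkowski_sub subr_lt0. Qed.

Lemma tauE p r : tau p r <-> 0 < q (p - r).
Proof. by rewrite minkowski_sub subr_gt0. Qed.

Lemma not_sigmaE p r : ~ sigma p r <-> 0 <= q (p - r).
Proof. by rewrite minkowski_sub subr_ge0 leNgt; split=> /negP. Qed.

(** * Causal vectors and the reverse triangle inequality *)

Lemma minkowski_time0_le0 w : w 0 0 = 0 -> q w <= 0.
Proof.
by move=> w0; rewrite /B w0 mulr0 sub0r oppr_le0 sumr_ge0 // => i _;
  rewrite -expr2 sqr_ge0.
Qed.

Lemma minkowski_time0_eq0 w : w 0 0 = 0 -> 0 <= q w -> w = 0.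
Proof.
move=> w0; rewrite /B w0 mulr0 sub0r oppr_ge0 => le0.
have sq_ge0 (i : 'I_n.+1) : (0 < i)%N -> 0 <= w 0 i * w 0 i.
  by move=> _; rewrite -expr2 sqr_ge0.
have /eqP : \sum_(i < n.+1 | (0 < i)%N) w 0 i * w 0 i = 0.
  by apply/le_anti; rewrite le0 sumr_ge0.
rewrite psumr_eq0 // => /allP w_eq0; apply/rowP => i; rewrite mxE.
have [i_gt0|i_le0] := ltnP 0 i; last first.
  by rewrite -w0; congr (w 0 _); apply/val_inj/eqP; rewrite -leqn0.
by have /implyP/(_ i_gt0) := w_eq0 i (mem_index_enum i); rewrite mulf_eq0 orbb => /eqP.
Qed.

(** A null difference with time coordinate 0 vanishes, so [p <> r] yields the clause of [lambda] on
    time coordinates. *)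
Lemma not_sigma_cases p r : ~ sigma p r -> p <> r -> tau p r \/ lambda p r.
Proof.
rewrite not_sigmaE => q_ge0 pr; have [|q_le0] := ltP 0 (q (p - r)).
  by left; apply/tauE.
right; split.
  by apply/eqP; rewrite -subr_eq0 -minkowski_sub; apply/eqP/le_anti/andP.
move=> t0; apply/pr/subr0_eq/minkowski_time0_eq0 => //.
by rewrite !mxE t0 subrr.
Qed.

(* Compare [r] with its multiple of [p] at the same time: the difference has
   time coordinate 0, hence [q <= 0]. *)
Lemma causal_minkowski_ge0 p r :
  0 <= q p -> 0 <= q r -> 0 <= p 0 0 * r 0 0 -> 0 <= B p r.
Proof.
move=> qp qr pr0; have [p0|p0] := eqVneq (p 0 0) 0.
  by rewrite (minkowski_time0_eq0 p0 qp) -(scale0r 0) minkowskiZl mul0r.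
have [r0|r0] := eqVneq (r 0 0) 0.
  by rewrite (minkowski_time0_eq0 r0 qr) -(scale0r 0) minkowskiZr mul0r.
have pr_gt0 : 0 < p 0 0 * r 0 0 by rewrite lt_neqAle eq_sym mulf_neq0.
have : q (p 0 0 *: r - r 0 0 *: p) <= 0.
  by apply: minkowski_time0_le0; rewrite !mxE mulrC subrr.
rewrite !minkowskiE (minkowskiC r p) => le0.
(* By [le0], twice the product below is at least [(p 0 0)^2 * q r + (r 0 0)^2 * q p]. *)
rewrite -(pmulr_rge0 _ pr_gt0).
have := mulr_ge0 (sqr_ge0 (p 0 0)) qr; have := mulr_ge0 (sqr_ge0 (r 0 0)) qp.
by lra.
Qed.

Lemma causalD p r :
  0 <= q p -> 0 <= q r -> 0 <= p 0 0 * r 0 0 -> 0 <= q (p + r).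
Proof.
move=> qp qr pr0; rewrite !minkowskiE (minkowskiC r p).
by have := causal_minkowski_ge0 qp qr pr0; lra.
Qed.

(** * Timelike pairs *)

(** If [z - u] points in the same time direction as [u - x], their sum [z - x] is causal; otherwise
    [u - z] points like [y - u], and [y - z] is causal. *)
Lemma causal_diamond x y u z :
    0 <= q (u - x) -> 0 <= q (y - u) -> 0 < (u - x) 0 0 * (y - u) 0 0 ->
  ~ sigma z u -> sigma z x -> sigma z y -> False.
Proof.
rewrite not_sigmaE !sigmaE => qux qyu uy qzu qzx qzy.
have [t_ge0|t_lt0] := leP 0 ((z - u) 0 0 * (u - x) 0 0).
  by have := causalD qzu qux t_ge0; rewrite addrA subrK leNgt qzx.
have t_ge0 : 0 <= (y - u) 0 0 * (u - z) 0 0.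
  have a2 : 0 < (u - x) 0 0 ^+ 2.
    by rewrite exprn_even_gt0 //=; apply: contraTneq uy => ->; rewrite mul0r ltxx.
  have -> : (u - z) 0 0 = - (z - u) 0 0 by rewrite !mxE opprB.
  (* Multiplying by a positive square lets the signs in [uy] and [t_lt0] combine. *)
  rewrite -(pmulr_rge0 _ a2).
  by have := mulr_ge0_le0 (ltW uy) (ltW t_lt0); lra.
rewrite minkowski_distC in qzu.
by have := causalD qyu qzu t_ge0; rewrite addrA subrK minkowski_distC leNgt qzy.
Qed.

Lemma timelike_diamond x y : (0 < n)%N -> tau x y ->
  exists u v, sigma u v /\
    forall w, w = u \/ w = v ->
      forall z, ~ sigma z w -> sigma z x -> ~ sigma z y.
Proof.
move=> n_gt0 /tauE qxy; set d := 2^-1 *: (y - x).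
have qd : 0 < q d.
  by rewrite minkowskiZl minkowskiZr minkowski_distC; lra.
have yE : y = x + d + d.
  rewrite -addrA -scalerDl; have -> : 2^-1 + 2^-1 = 1 :> Q by [lra].
  by rewrite scale1r addrC subrK.
clearbody d.
(* The last axis is spatial because [0 < n]. *)
pose e : 'rV[Q]_n.+1 := delta_mx 0 ord_max.
have ord_max_neq0 : (ord0 == ord_max :> 'I_n.+1) = false.
  by apply/negbTE; rewrite -val_eqE /= eq_sym -lt0n.
have e0 : e 0 0 = 0 by rewrite mxE eqxx ord_max_neq0.
have qe : q e = -1.
  rewrite /B e0 mul0r sub0r (bigD1 ord_max) //= big1; last first.
    by move=> i /andP[_ /negbTE i_max]; rewrite mxE eqxx i_max mul0r.
  by rewrite mxE !eqxx addr0 mulr1.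
clearbody e.
(* Since [eps <= 1], [q (d + s *: e)] with [|s| = eps] is at least [q d - 2 * eps * |B d e| - eps],
   which equals [eps * q d] by this choice. *)
pose eps := q d / (2 * `|B d e| + 1 + q d).
have den_gt0 : 0 < 2 * `|B d e| + 1 + q d by have := normr_ge0 (B d e); lra.
have eps_gt0 : 0 < eps by rewrite divr_gt0.
have epsE : eps * (2 * `|B d e| + 1 + q d) = q d by rewrite divfK ?gt_eqF.
have eps_le1 : eps <= 1.
  by rewrite ler_pdivrMr // mul1r; have := normr_ge0 (B d e); lra.
clearbody eps.
have q_pm s : `|s| = eps -> 0 <= q (d + s *: e).
  move=> s_eps; have s2 : s ^+ 2 = eps ^+ 2 by rewrite -s_eps real_normK ?num_real.
  have sB : - (eps * `|B d e|) <= s * B d e.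
    by rewrite lerNl -s_eps -normrM -normrN ler_norm.
  rewrite !minkowskiE (minkowskiC e d) qe.
  by have := mulr_gt0 eps_gt0 qd; nra.
have d0 : d 0 0 != 0.
  by apply: contraL qd => /eqP d0; rewrite -leNgt minkowski_time0_le0.
have diamond s : `|s| = eps -> forall z,
    ~ sigma z (x + d + s *: e) -> sigma z x -> ~ sigma z y.
  move=> s_eps z zw zx zy.
  have wx : x + d + s *: e - x = d + s *: e by rewrite -!addrA addrC addrA addrNK.
  have yw : y - (x + d + s *: e) = d + (- s) *: e.
    by rewrite yE opprD addrA [_ - (x + d)]addrC addKr scaleNr.
  apply: (causal_diamond (u := x + d + s *: e) (z := z) (x := x) (y := y)) => //.
  - by rewrite wx q_pm.
  - by rewrite yw q_pm ?normrN.
  (* Both differences have time coordinate [d 0 0], as [e] has none. *)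
  - rewrite wx yw !(mxE _ _ 0 0) -!/(d 0 0) -/(e 0 0) e0.
    by rewrite !mulr0 !addr0 -expr2 exprn_even_gt0.
exists (x + d + eps *: e), (x + d + (- eps) *: e); split.
  apply/sigmaE; rewrite opprD addrACA subrr add0r -scaleNr opprK -scalerDl.
  by rewrite !minkowskiE qe; nra.
by move=> w [] ->; apply: diamond; rewrite ?normrN gtr0_norm.
Qed.

(** * Lightlike pairs *)

(** The two expressions are the values of [q] along parallel lines in a null direction, with common
    slope [2 * s]; [t] makes the increment fall below both [- a] and [- b]. *)
Lemma affine_both_lt0 (a b s : Q) :
  s != 0 -> exists t, a + 2 * t * s < 0 /\ b + 2 * t * s < 0.
Proof.
move=> s0; exists (- (`|a| + `|b| + 1) / s).
have -> : 2 * (- (`|a| + `|b| + 1) / s) * s = - 2 * (`|a| + `|b| + 1) by field.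
by have := ler_norm a; have := ler_norm b; have := normr_ge0 a;
  have := normr_ge0 b; lra.
Qed.

Lemma null_line_or_spacelike k p : q k = 0 -> k 0 0 != 0 ->
  (exists c, p = c *: k) \/
  exists z, [/\ 0 <= q (z - p), q z < 0 & q (z - k) < 0].
Proof.
move=> qk k0; have [Bpk|Bpk] := eqVneq (B p k) 0; last first.
  right; have [t [q1 q2]] := affine_both_lt0 (q p) (q (p - k)) Bpk.
  exists (p + t *: k); rewrite [p + _ - p]addrC addKr; move: q1 q2.
  by rewrite !minkowskiE (minkowskiC k p) qk => q1 q2; split; lra.
have [qp|qp] := ltP (q p) 0.
  right; exists p; rewrite subrr -(scale0r p) minkowskiZl mul0r.
  by split=> //; rewrite !minkowskiE (minkowskiC k p) Bpk qk; lra.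
(* This multiple of [k] has the time coordinate of [p]; subtracting it keeps [q p >= 0], as [q k]
   and [B p k] vanish. *)
left; exists (p 0 0 / k 0 0); apply/subr0_eq/minkowski_time0_eq0.
  by rewrite !mxE divfK ?subrr.
by rewrite !minkowskiE (minkowskiC k p) Bpk qk; lra.
Qed.

Lemma lambda_line_or_spacelike x y u : lambda x y ->
  (exists c, u = x + c *: (y - x)) \/
  exists z, [/\ ~ sigma z u, sigma z x & sigma z y].
Proof.
move=> [txy xy0].
have qk : q (y - x) = 0 by rewrite minkowski_distC minkowski_sub txy subrr.
have k0 : (y - x) 0 0 != 0 by rewrite !mxE subr_eq0 eq_sym; apply/eqP.
have [[c cE]|[z [zu zx zy]]] := null_line_or_spacelike (u - x) qk k0.
  by left; exists c; rewrite -cE addrC subrK.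
right; exists (z + x); split.
- by apply/not_sigmaE; move: zu; rewrite opprB addrA.
- by apply/sigmaE; rewrite addrK.
- by apply/sigmaE; move: zy; rewrite opprB addrA.
Qed.

Lemma lambda_line_not_sigma x y (c c' : Q) : lambda x y ->
  ~ sigma (x + c *: (y - x)) (x + c' *: (y - x)).
Proof.
move=> [txy _]; apply/not_sigmaE; rewrite opprD addrACA subrr add0r -scalerBl.
by rewrite minkowskiZl minkowskiZr minkowski_distC minkowski_sub txy subrr !mulr0.
Qed.

Lemma lambda_spacelike_witness x y u v : lambda x y -> sigma u v ->
  exists z, [/\ ~ sigma z u \/ ~ sigma z v, sigma z x & sigma z y].
Proof.
move=> xy uv.
have [[c uE]|[z [zu zx zy]]] := lambda_line_or_spacelike u xy; last first.
  by exists z; split=> //; left.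
have [[c' vE]|[z [zv zx zy]]] := lambda_line_or_spacelike v xy; last first.
  by exists z; split=> //; right.
by case: (@lambda_line_not_sigma x y c c' xy); rewrite -uE -vE.
Qed.

(** * Definability of [lambda] and [tau] *)

Lemma lambda_not_sigma x y : lambda x y -> ~ sigma x y.
Proof. by rewrite /sigma => -[-> _]; rewrite ltxx. Qed.

Lemma tau_not_sigma x y : tau x y -> ~ sigma x y.
Proof. by rewrite /sigma /tau => /lt_trans yx /yx; rewrite ltxx. Qed.

Lemma tau_neq x y : tau x y -> x <> y.
Proof.
by move=> + xy; rewrite xy => /tauE; rewrite subrr -(scale0r 0) minkowskiZl mul0r ltxx.
Qed.

Lemma lambda_neq x y : lambda x y -> x <> y.
Proof. by move=> [_ xy0] xy; apply: xy0; rewrite xy. Qed.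

Lemma lambda_not_tau x y : lambda x y -> ~ tau x y.
Proof. by rewrite /tau => -[-> _]; rewrite ltxx. Qed.

Lemma W_sigma_lambda_defines :
  (0 < n)%N -> defines (@sigma Q n) W_sigma_lambda (@lambda Q n).
Proof.
move=> n_gt0 e; rewrite /= /update /=; split=> [[[Nxy xy]] W|xy].
  have [/(timelike_diamond n_gt0)[u [v [uv uvP]]]|//] := not_sigma_cases Nxy xy.
  have [zu [zv [[[[zw zx] zy]|[[zw zx] zy]]|//]]] := W u v.
    by case: (uvP u (or_introl erefl) zu zw zx zy).
  by case: (uvP v (or_intror erefl) zv zw zx zy).
split; first by split; [apply: lambda_not_sigma | apply: lambda_neq].
(* Without [sigma u v] the last disjunct holds and the witnesses are arbitrary; otherwise one [z]
   serves as both. *)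
move=> u v; have [uv|Nuv] := classic (sigma u v); last by exists u, u; right.
have [z [[zu|zv] zx zy]] := lambda_spacelike_witness xy uv; exists z, z; left.
  by left.
by right.
Qed.

Lemma W_sigma_tau_defines :
  (0 < n)%N -> defines (@sigma Q n) W_sigma_tau (@tau Q n).
Proof.
move=> n_gt0 e; have We := W_sigma_lambda_defines n_gt0 e.
rewrite /W_sigma_tau; split=> [[[/= NW Nxy] xy]|xy].
  by have [//|/We] := not_sigma_cases Nxy xy.
split; [split|] => /=; [|exact: tau_not_sigma|exact: tau_neq].
by move=> /We /lambda_not_tau.
Qed.

End Minkowski.

(** * Prenex forms *)

Definition W_sigma_lambda_base : formula :=
  fAnd (fNot (fRel vx vy)) (fNot (fEq vx vy)).

Definition W_sigma_lambda_matrix : formula :=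
  fOr (fOr
    (fAnd (fAnd (fNot (fRel vzu vu)) (fRel vzu vx)) (fRel vzu vy))
    (fAnd (fAnd (fNot (fRel vzv vv)) (fRel vzv vx)) (fRel vzv vy)))
    (fNot (fRel vu vv)).

Definition W_sigma_lambda_prenex : formula :=
  fAll vu (fAll vv (fEx vzu (fEx vzv
    (fAnd W_sigma_lambda_base W_sigma_lambda_matrix)))).

(** In conjunction with the base, the negation of [W_sigma_lambda_prenex] only has to negate the
    matrix. *)
Definition W_sigma_tau_prenex : formula :=
  fEx vu (fEx vv (fAll vzu (fAll vzv
    (fAnd W_sigma_lambda_base (fNot W_sigma_lambda_matrix))))).

(** The base mentions only [vx] and [vy], so it moves under the quantifiers without renaming. *)
Lemma W_sigma_lambda_prenexE :
  logically_equivalent W_sigma_lambda W_sigma_lambda_prenex.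
Proof.
move=> A r e; rewrite /= /update /=; split=> [[base W] u v|W].
  by have [zu [zv M]] := W u v; exists zu, zv.
(* Recovering the base takes an instance of the universal quantifiers; the assignment supplies a
   point. *)
split; first by have [zu [zv []]] := W (e 0) (e 0).
by move=> u v; have [zu [zv [_ M]]] := W u v; exists zu, zv.
Qed.

Lemma W_sigma_tau_prenexE :
  logically_equivalent W_sigma_tau W_sigma_tau_prenex.
Proof.
move=> A r e.
(* The last two conjuncts of [W_sigma_tau] together form the base. *)
have -> : sat r e W_sigma_tau <->
    ~ sat r e W_sigma_lambda_prenex /\ sat r e W_sigma_lambda_base.
  have [WP PW] := W_sigma_lambda_prenexE r e.
  by split=> [[[NW Nxy] xy]|[NP [Nxy xy]]]; split=> //; [move=> /PW|split=> // /WP].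
rewrite /= /update /=; split=> [[NW base]|[u [v NM]]]; last first.
  split; first by move=> /(_ u v) [zu [zv [_ M]]]; have [_] := NM zu zv; apply.
  by have [] := NM u u.
have [u /not_all_ex_not [v Nuv]] := not_all_ex_not _ _ NW.
by exists u, v => zu zv; split=> // M; apply: Nuv; exists zu, zv.
Qed.

Theorem theorem4p13 (Q : realFieldType) (n : nat) (hn : 2 <= n.+1)
    (hQ : n.+1 = 2 \/ euclidean_field Q) :
  [/\ defines (@sigma Q n) W_sigma_lambda (@lambda Q n),
      num_vars W_sigma_lambda = 6 /\
      (exists psi : formula,
        [/\ is_forall2_exists2 psi, num_vars psi = 6
          & logically_equivalent W_sigma_lambda psi]),
      defines (@sigma Q n) W_sigma_tau (@tau Q n)
    & exists psi : formula,
        is_exists2_forall2 psi /\ logically_equivalent W_sigma_tau psi].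
Proof.
split.
- exact: W_sigma_lambda_defines.
- split=> //; exists W_sigma_lambda_prenex; split=> //.
  exact: W_sigma_lambda_prenexE.
- exact: W_sigma_tau_defines.
- exists W_sigma_tau_prenex; split=> //; exact: W_sigma_tau_prenexE.
Qed.
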